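(* Let $p\ge 5$ be a prime and let $n$ be a positive integer. Then $$\alpha_{np}\equiv \left(\frac{p}{3}\right)\alpha_n \pmod{p^2},$$ and $$\beta_{np}\equiv \begin{cases}\beta_n \pmod{p^2}, & \text{if } p\equiv 1\pmod 3,\\ -\gamma_n \pmod{p^2}, & \text{if } p\equiv 2\pmod 3.\end{cases}$$
   Context: For a positive integer $m$, define $$\alpha_m=\sum_{k=0}^{m-1}\binom{2k}{k},\qquad \beta_m=\sum_{k=0}^{m-1}\binom{2k}{k}\frac{1}{k+1},\qquad \gamma_m=\sum_{k=0}^{m-1}\binom{2k}{k}\frac{3k+2}{k+1}.$$ All of these are integers. Here $\left(\frac{p}{3}\right)$ denotes the Legendre symbol modulo $3$, so for a prime $p\ge5$ it equals $1$ if $p\equiv 1\pmod 3$ and $-1$ if $p\equiv 2\pmod 3$. *)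

(* Defs.v *)
From mathcomp Require Import all_boot all_order all_algebra.

Set Implicit Arguments.
Unset Strict Implicit.
Unset Printing Implicit Defensive.

Import Order.TTheory GRing.Theory Num.Theory.

Local Open Scope ring_scope.

Definition alpha (m : nat) : nat := (\sum_(k < m) 'C(2 * k, k))%N.

(* The divisions [%/] in [beta] and [gamma] are exact: see [betaE], [gammaE]. *)
Definition beta (m : nat) : nat := (\sum_(k < m) 'C(2 * k, k) %/ k.+1)%N.

Definition gamma (m : nat) : nat :=
  (\sum_(k < m) ('C(2 * k, k) * (3 * k + 2)) %/ k.+1)%N.

(* The Legendre symbol (a / q), meant for an odd prime q. *)
Definition legendre (a q : nat) : int :=
  if (q %| a)%N then 0
  else if [exists x : 'I_q, (x ^ 2 == a %[mod q])%N] then 1 else -1.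

Lemma dvdn_central_bin (k : nat) : (k.+1 %| 'C(2 * k, k))%N.
Proof.
have e : (k.+1 * 'C(2 * k, k.+1) = k * 'C(2 * k, k))%N.
  by rewrite mul_bin_left mul2n -addnn addnK.
have h : (k.+1 %| k * 'C(2 * k, k))%N by rewrite -e dvdn_mulr.
by rewrite -(dvdn_addr _ h) -mulSnr dvdn_mulr.
Qed.

Lemma divn_ratE (a d : nat) :
  (d.+1 %| a)%N -> (a %/ d.+1)%N%:R = a%:R / d.+1%:R :> rat.
Proof.
by move=> dv; rewrite -{2}(divnK dv) natrM mulfK // pnatr_eq0.
Qed.

Lemma betaE (m : nat) :
  (beta m)%:R = \sum_(k < m) 'C(2 * k, k)%:R * (1 / k.+1%:R) :> rat.
Proof.
rewrite natr_sum; apply: eq_bigr => k _.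
by rewrite mul1r divn_ratE // dvdn_central_bin.
Qed.

Lemma gammaE (m : nat) :
  (gamma m)%:R
    = \sum_(k < m) 'C(2 * k, k)%:R * ((3 * k + 2)%N%:R / k.+1%:R) :> rat.
Proof.
rewrite natr_sum; apply: eq_bigr => k _.
by rewrite divn_ratE ?natrM ?mulrA // dvdn_mulr // dvdn_central_bin.
Qed.

Lemma legendre3E (p : nat) :
  legendre p 3 = if (p %% 3 == 0)%N then 0
                 else if (p %% 3 == 1)%N then 1 else -1.
Proof.
rewrite /legendre /dvdn; case: eqP => // p0; congr (if _ then _ else _).
apply/existsP/eqP => [[x /eqP e]|e].
  by move: p0; rewrite -e; case: x {e} => [[|[|[|]]]].
by exists (inord 1); rewrite inordK // e.
Qed.

(* Main.v *)
Require Import Defs.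
From HB Require Import structures.
From mathcomp Require Import all_boot all_order all_algebra.
From mathcomp Require Import zify ring.

Set Implicit Arguments.
Unset Strict Implicit.
Unset Printing Implicit Defensive.

Import Order.TTheory GRing.Theory Num.Theory.

Local Open Scope ring_scope.

(** Every sum in the statement is a coefficient of a power series with
    denominator Phi = 1 + X + X^2.  Put y = (1 + X)^2 / X, so that 'C(2k, k) is
    the constant term of y^k and y - 1 = Phi / X.  Summing the geometric
    series 1 + y + ... + y^(m-1) = (y^m - 1) / (y - 1) shows that alpha_m is
    the coefficient of X^(m-1) in (1 + X)^(2m) / Phi, and that the coefficient
    of X^(m-2) is delta_m = \sum_(k < m) 'C(2k, k+1)
    ([alpha_phi3_coef], [delta_phi3_coef]).  The Catalan identity
    'C(2k, k) / (k+1) = 'C(2k, k) - 'C(2k, k+1) then gives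
    beta = alpha - delta and gamma = 2 alpha + delta.  Since
    1 / Phi = (1 - X) / (1 - X^3), its coefficients are the values of the
    Legendre symbol modulo 3.

    Now let m = n p.  The polynomial (1 + X)^p - 1 - X^p is divisible by Phi
    (Cauchy), because modulo Phi it is -(1 + X^p + X^(2p)) and 3 does not
    divide p; it is also divisible by p.  Write it as Phi * K, with K of degree
    at most p - 3.  In the expansion of (1 + X)^(2np) = (1 + X^p + Phi K)^(2n)
    the terms of order at least two in Phi K vanish modulo p^2, and the linear
    term divided by Phi is 2n K (1 + X^p)^(2n-1), all of whose exponents are
    congruent modulo p to one of 0, ..., p - 3.  The exponents np - 1 and
    np - 2 are not, so modulo p^2 the sums for n p are the corresponding
    coefficients of (1 + X^p)^(2n) / Phi ([phi3_coef_frobenius]), that is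
      \sum_i 'C(2n, i) ((p (n-i) - e) / 3)  with e = 0 or 1,
    and these reduce to alpha_n and delta_n by the multiplicativity and the
    3-periodicity of the symbol. *)

(** * The Legendre symbol modulo 3 *)

Lemma legendre3_mod (a b : nat) :
  (a = b %[mod 3])%N -> legendre a 3 = legendre b 3.
Proof. by move=> e; rewrite !legendre3E e. Qed.

Lemma legendre3M (a b : nat) : legendre (a * b) 3 = legendre a 3 * legendre b 3.
Proof.
rewrite !legendre3E -modnMm.
have: (a %% 3 < 3)%N by rewrite ltn_mod.
have: (b %% 3 < 3)%N by rewrite ltn_mod.
by case: (a %% 3)%N => [|[|[|]]] //; case: (b %% 3)%N => [|[|[|]]].
Qed.

Lemma legendre3_sum (k : nat) :
  legendre k 3 + legendre k.+1 3 + legendre k.+2 3 = 0.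
Proof.
rewrite !legendre3E -(addn2 k) -(addn1 k) -(modnDml k 1) -(modnDml k 2).
have: (k %% 3 < 3)%N by rewrite ltn_mod.
by case: (k %% 3)%N => [|[|[|]]].
Qed.

Lemma legendre3_pred_mul1 (p t : nat) :
  (0 < p)%N -> (p = 1 %[mod 3])%N ->
  legendre (p * t).-1 3 = legendre t.-1 3.
Proof.
case: t => [|t] p_gt0 p1; first by rewrite muln0.
by apply: legendre3_mod; nia.
Qed.

Lemma legendre3_pred_mul2 (p t : nat) :
  (0 < p)%N -> (p = 2 %[mod 3])%N ->
  legendre (p * t).-1 3 = legendre t 3 + legendre t.-1 3.
Proof.
case: t => [|t] p_gt0 p2; first by rewrite muln0 /= !legendre3E.
(* p t - 1 = 2 t - 1 = 2 (t + 1) modulo 3, and 2 has symbol -1. *)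
rewrite (@legendre3_mod _ (2 * t.+2)) ?legendre3M; last by nia.
have -> : legendre 2 3 = -1 by rewrite legendre3E.
by have := legendre3_sum t => /=; lia.
Qed.

(** * Coefficients of quotients by 1 + X + X^2 *)

Definition phi3 : {poly int} := 1 + 'X + 'X^2.

(** The coefficient of X^(N-1) in the power series P / phi3, and 0 for N = 0.
    The truncated subtraction and the value 0 of the symbol at 0 make
    the range of summation immaterial beyond N. *)
Definition phi3_coef (N : nat) (P : {poly int}) : int :=
  \sum_(i < N) P`_i * legendre (N - i) 3.

Lemma phi3_coef_is_linear (N : nat) : linear_for *%R (phi3_coef N).
Proof.
move=> a P Q; rewrite /phi3_coef mulr_sumr -big_split /=.
by apply: eq_bigr => i _; rewrite coefD coefZ mulrDl mulrA.
Qed.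

HB.instance Definition _ (N : nat) :=
  GRing.isLinear.Build int {poly int} int *%R (phi3_coef N)
    (phi3_coef_is_linear N).

Lemma phi3_coef_mulX (N : nat) (P : {poly int}) :
  phi3_coef N ('X * P) = phi3_coef N.-1 P.
Proof.
case: N => [|N]; first by rewrite /phi3_coef !big_ord0.
rewrite /phi3_coef big_ord_recl coefXM mul0r add0r /=.
by apply: eq_bigr => i _; rewrite coefXM.
Qed.

Lemma phi3_coef_widen (M N : nat) (P : {poly int}) :
  (N <= M)%N -> phi3_coef N P = \sum_(i < M) P`_i * legendre (N - i) 3.
Proof.
move=> le_NM; rewrite /phi3_coef.
rewrite (big_ord_widen M (fun i => P`_i * legendre (N - i) 3)) //.
rewrite [RHS](bigID (fun i : 'I_M => (i < N)%N)) /=.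
rewrite [X in _ + X]big1 ?addr0 //.
by move=> i; rewrite -leqNgt -subn_eq0 => /eqP->; rewrite legendre3E mulr0.
Qed.

Lemma phi3_coef_Xn (N k : nat) : phi3_coef N 'X^k = legendre (N - k) 3.
Proof.
rewrite (@phi3_coef_widen (N + k).+1); last by lia.
have k_lt : (k < (N + k).+1)%N by lia.
rewrite (bigD1 (Ordinal k_lt)) //= coefXn eqxx mul1r big1 ?addr0 // => i.
by rewrite -val_eqE /= coefXn => /negPf->; rewrite mul0r.
Qed.

(** The series \sum_k (legendre k 3) X^k times phi3 is X: this is what makes
    [phi3_coef] compute quotients by phi3. *)
Lemma phi3_coef_mulphi3 (N : nat) (Q : {poly int}) :
  phi3_coef N (phi3 * Q) = ('X * Q)`_N.
Proof.
rewrite /phi3 !mulrDl mul1r expr2 -mulrA !raddfD /= !phi3_coef_mulX.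
rewrite !(@phi3_coef_widen N) -?subn1 -?subnDA ?leq_subr //.
rewrite -!big_split /= coefXM; case: N => [|N]; first by rewrite big_ord0.
(* The three symbols add up to 0, except next to the truncation, at i = N. *)
rewrite big_ord_recr big1 /= => [|i _].
  have -> : (N.+1 - N = 1)%N by lia.
  have -> : (N.+1 - 1 - N = 0)%N by lia.
  have -> : (N.+1 - (1 + 1) - N = 0)%N by lia.
  by rewrite !legendre3E; ring.
set m := (N.+1 - (1 + 1) - i)%N; have i_lt := ltn_ord i.
have -> : (N.+1 - i = m.+2)%N by lia.
have -> : (N.+1 - 1 - i = m.+1)%N by lia.
by rewrite -!mulrDr addrAC addrC addrA addrC addrA legendre3_sum mulr0.
Qed.

(** * The sums as coefficients *)

Lemma coef_1DXn (n k : nat) : ((1 + 'X) ^+ n : {poly int})`_k = 'C(n, k)%:R.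
Proof.
rewrite exprDn coef_sum.
under eq_bigr => i _ do rewrite expr1n mul1r coefMn coefXn.
have [k_le | n_lt] := leqP k n.
  rewrite (bigD1 (Ordinal (n := n.+1) (m := k) k_le)) //= eqxx.
  rewrite big1 ?addr0 // => i.
  by rewrite -val_eqE eq_sym /= => /negPf->; rewrite mul0rn.
rewrite bin_small // big1 // => i _.
have /negPf-> : (k != i)%N by have := ltn_ord i; lia.
by rewrite mul0rn.
Qed.

(** The geometric series (y^m - 1) / (y - 1) for y = (1 + X)^2 / X, cleared of
    denominators. *)
Lemma phi3_mul_geometric (m : nat) :
  (1 + 'X) ^+ (2 * m) =
    'X^m + phi3 * \sum_(k < m) 'X^(m.-1 - k) * (1 + 'X) ^+ (2 * k).
Proof.
under eq_bigr => k _ do rewrite exprM.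
have -> : phi3 = - ('X - (1 + 'X) ^+ 2) by rewrite /phi3; ring.
by rewrite mulNr -subrXX exprM; ring.
Qed.

(** The term X^m of the geometric identity only affects the quotient by phi3
    from the exponent m on, beyond the exponent N - 1 that is read off. *)
Lemma phi3_coef_1DXn (m N : nat) :
  (N <= m)%N ->
  phi3_coef N ((1 + 'X) ^+ (2 * m)) =
    \sum_(k < m) ('X * ('X^(m.-1 - k) * (1 + 'X) ^+ (2 * k)))`_N.
Proof.
move=> le_Nm; rewrite phi3_mul_geometric raddfD /= phi3_coef_Xn phi3_coef_mulphi3.
by rewrite (eqP le_Nm) legendre3E add0r mulr_sumr coef_sum.
Qed.

Lemma alpha_phi3_coef (m : nat) :
  (alpha m)%:Z = phi3_coef m ((1 + 'X) ^+ (2 * m)).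
Proof.
rewrite phi3_coef_1DXn // /alpha -natz natr_sum.
apply: eq_bigr => k _; have k_lt := ltn_ord k.
rewrite coefXM coefXnM coef_1DXn.
have -> : (m == 0)%N = false by lia.
have -> : (m.-1 < m.-1 - k)%N = false by lia.
by congr (_%:R); congr ('C(_, _)); lia.
Qed.

Definition delta (m : nat) : nat := (\sum_(k < m) 'C(2 * k, k.+1))%N.

Lemma delta_phi3_coef (m : nat) :
  (delta m)%:Z = phi3_coef m.-1 ((1 + 'X) ^+ (2 * m)).
Proof.
rewrite phi3_coef_1DXn ?leq_pred // /delta -natz natr_sum.
apply: eq_bigr => k _; have k_lt := ltn_ord k.
rewrite coefXM coefXnM coef_1DXn.
have [k0 | k_gt0] := posnP k.
  (* The summand k = 0 is X^(m-1), which does not contribute at m - 2. *)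
  rewrite k0 bin_small //.
  case: (m.-1 =P 0)%N => // m1_neq0.
  by have -> : (m.-2 < m.-1 - 0)%N = true by lia.
have -> : (m.-1 == 0)%N = false by lia.
have -> : (m.-2 < m.-1 - k)%N = false by lia.
rewrite -bin_sub; last by lia.
by congr (_%:R); congr ('C(_, _)); lia.
Qed.

Lemma catalan_bin (k : nat) :
  ('C(2 * k, k) %/ k.+1 + 'C(2 * k, k.+1) = 'C(2 * k, k))%N.
Proof.
have e : (k.+1 * 'C(2 * k, k.+1) = k * 'C(2 * k, k))%N.
  by rewrite mul_bin_left mul2n -addnn addnK.
by have := divnK (dvdn_central_bin k); nia.
Qed.

Lemma beta_delta (m : nat) : (beta m + delta m = alpha m)%N.
Proof.
rewrite /beta /delta -big_split /=.
by apply: eq_bigr => k _; apply: catalan_bin.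
Qed.

Lemma gamma_beta (m : nat) : (gamma m + beta m = 3 * alpha m)%N.
Proof.
rewrite /gamma /beta -big_split big_distrr /=.
apply: eq_bigr => k _; rewrite -{1 2}(divnK (dvdn_central_bin k)).
by rewrite mulnAC !mulnK //; have := divnK (dvdn_central_bin k); nia.
Qed.

(** * The p-th power of 1 + X *)

Lemma exprD_order2 (R : comNzRingType) (A D : R) (M : nat) :
  exists Q, (A + D) ^+ M = A ^+ M + D * (A ^+ M.-1 *+ M) + D ^+ 2 * Q.
Proof.
elim: M => [|M [Q IH]]; first by exists 0; rewrite !expr0 mulr0n; ring.
exists (A ^+ M.-1 *+ M + (A + D) * Q); rewrite exprS IH.
have -> : A ^+ M.+1.-1 *+ M.+1 = A ^+ M + A * (A ^+ M.-1 *+ M).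
  by case: M {IH} => [|M]; rewrite ?mulr0n ?mulr0 ?addr0 // mulrnAr -exprS -mulrS.
by rewrite (exprS A M); ring.
Qed.

Lemma phi3_dvd_Xn_mod3 (q r : nat) : exists K, 'X^(q * 3 + r) = 'X^r + phi3 * K.
Proof.
exists ('X^r * ('X - 1) * \sum_(i < q) ('X^3) ^+ i).
have -> : phi3 * ('X^r * ('X - 1) * \sum_(i < q) ('X^3) ^+ i)
          = 'X^r * (('X^3 - 1) * \sum_(i < q) ('X^3) ^+ i) by rewrite /phi3; ring.
by rewrite -subrX1 exprD mulnC exprM; ring.
Qed.

(** A primitive cube root of unity w gives 1 + w^p + w^(2p) = 0 when 3 does not
    divide p; the two nonzero residues of p modulo 3 give the two witnesses. *)
Lemma phi3_dvd_cyclotomic (p : nat) :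
  ~~ (3 %| p)%N -> exists K, 1 + 'X^p + 'X^(2 * p) = phi3 * K.
Proof.
move=> p3; rewrite mul2n -addnn exprD (divn_eq p 3).
have [K ->] := phi3_dvd_Xn_mod3 (p %/ 3) (p %% 3).
have : (p %% 3 < 3)%N by rewrite ltn_mod.
move: p3; rewrite /dvdn; case: (p %% 3)%N => [|[|[|]]] // _ _.
  by exists (1 + K + 2%:R * 'X * K + phi3 * K ^+ 2); rewrite /phi3; ring.
exists (K + 2%:R * 'X^2 * K + phi3 * K ^+ 2 + 1 - 'X + 'X^2).
by rewrite /phi3; ring.
Qed.

(** Modulo phi3, 1 + X is - X^2, so that (1 + X)^p is - X^(2p) for odd p. *)
Lemma cauchy_phi3_dvd (p : nat) :
  odd p -> ~~ (3 %| p)%N -> exists K, (1 + 'X) ^+ p = 1 + 'X^p + phi3 * K.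
Proof.
move=> p_odd /phi3_dvd_cyclotomic[K eK].
exists (\sum_(i < p) (1 + 'X) ^+ (p.-1 - i) * (- 'X^2) ^+ i - K).
rewrite mulrBr -eK.
have -> : phi3 = (1 + 'X) - (- 'X^2) by rewrite /phi3; ring.
by rewrite -subrXX exprNn -signr_odd p_odd exprM; ring.
Qed.

Lemma frobenius_1DX (p : nat) :
  prime p -> exists G : {poly int}, (1 + 'X) ^+ p = 1 + 'X^p + p%:R * G.
Proof.
move=> p_pr; have p_gt1 := prime_gt1 p_pr.
exists (\poly_(i < p) (if i == 0 then 0 else ('C(p, i) %/ p)%N%:R)).
apply/polyP => i; rewrite coef_1DXn !coefD coef1 coefXn mulr_natl coefMn coef_poly.
have [->|i_neq0] := eqVneq i 0%N.
  by rewrite bin0 (ltnW p_gt1) mul0rn addr0; case: p p_gt1 {p_pr}.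
have [i_lt|lt_i|->] := ltngtP i p; last by rewrite binn mul0rn addr0 add0r.
  by rewrite !add0r -mulrnA divnK // prime_dvd_bin // lt0n i_neq0.
by rewrite bin_small // mul0rn !addr0.
Qed.

(** The leading terms of (1 + X)^p and X^p cancel, leaving degree at most p - 1
    for phi3 * K. *)
Lemma size_cauchy_quotient (p : nat) (K : {poly int}) :
  (0 < p)%N -> (1 + 'X) ^+ p = 1 + 'X^p + phi3 * K -> (size K <= p - 2)%N.
Proof.
move=> p_gt0 eK; have [->|K_neq0] := eqVneq K 0; first by rewrite size_poly0.
have phi3E : phi3 = 'X^2 + (1 + 'X) by rewrite /phi3; ring.
have size_1X : size (1 + 'X : {poly int}) = 2%N.
  by rewrite addrC -[1]/(1%:P) size_XaddC.
have size_phi3 : size phi3 = 3%N by rewrite phi3E size_polyDl size_polyXn ?size_1X.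
have phi3_monic : phi3 \is monic.
  by rewrite monicE phi3E lead_coefDl ?size_polyXn ?size_1X // lead_coefXn.
have : (size (phi3 * K)%R <= p)%N.
  have -> : phi3 * K = (1 + 'X) ^+ p - 1 - 'X^p by rewrite eK; ring.
  apply/leq_sizeP => i le_pi; rewrite !coefB coef_1DXn coef1 coefXn.
  have -> : (i == 0)%N = false by lia.
  have [->|i_neq] := eqVneq i p; first by rewrite binn.
  by rewrite bin_small //; lia.
by rewrite size_monicM // size_phi3 /=; lia.
Qed.

(** Every exponent of K (1 + X^p)^M is an exponent of K plus a multiple of p. *)
Lemma coef_mul_1DXpn (p M N : nat) (K : {poly int}) :
  (size K <= N %% p)%N -> (K * (1 + 'X^p) ^+ M)`_N = 0.
Proof.
move=> sizeK; rewrite exprDn mulr_sumr coef_sum big1 // => i _.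
rewrite expr1n mul1r mulrnAr coefMn -exprM coefMXn.
case: ltnP => [_|le_piN]; first by rewrite mul0rn.
rewrite nth_default ?mul0rn // (leq_trans sizeK) //.
by rewrite -{1}(subnK le_piN) addnC mulnC modnMDl leq_mod.
Qed.

(** * Reduction modulo p^2 *)

(** In (1 + X^p + phi3 K)^M, the terms of order at least two in phi3 K = p G are
    multiples of p^2.  The linear one becomes M K (1 + X^p)^(M-1) after division
    by phi3, and its coefficient of X^N is exactly 0, since the residue
    of N modulo p exceeds the degree of K.  *)
Lemma phi3_coef_frobenius (p M N : nat) :
  prime p -> (5 <= p)%N -> (p - 2 <= N %% p)%N ->
  (phi3_coef N.+1 ((1 + 'X) ^+ (p * M)) =
     phi3_coef N.+1 ((1 + 'X^p) ^+ M) %[mod (p ^ 2)%N%:Z])%Z.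
Proof.
move=> p_pr p_ge5 N_res.
have p_odd : odd p by case: (even_prime p_pr) => // p2; rewrite p2 in p_ge5.
have p3 : ~~ (3 %| p)%N by rewrite dvdn_prime2 //; lia.
have [K eK] := cauchy_phi3_dvd p_odd p3.
have [G eG] := frobenius_1DX p_pr.
have eKG : phi3 * K = p%:R * G.
  by apply: (addrI (1 + 'X^p)); rewrite -eK -eG.
have [Q eQ] := exprD_order2 (1 + 'X^p) (phi3 * K) M.
apply/eqP; rewrite eqz_mod_dvd exprM eK eQ !raddfD /= -mulrA phi3_coef_mulphi3.
rewrite coefXM /= mulrnAr coefMn coef_mul_1DXpn; last first.
  by apply: leq_trans N_res; apply: size_cauchy_quotient eK; lia.
rewrite mul0rn addr0 addrAC subrr add0r eKG exprMn -mulrA -natrX mulr_natl raddfMn /=.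
by rewrite -mulr_natl natz dvdz_mulr.
Qed.

Lemma phi3_coef_1DXpn (p M N : nat) :
  phi3_coef N ((1 + 'X^p) ^+ M) =
    \sum_(i < M.+1) 'C(M, i)%:R * legendre (N - p * i) 3.
Proof.
rewrite exprDn raddf_sum; apply: eq_bigr => i _ /=.
by rewrite expr1n mul1r raddfMn /= -exprM phi3_coef_Xn mulr_natl.
Qed.

Lemma alpha_legendre (n : nat) :
  (alpha n)%:Z = \sum_(i < (2 * n).+1) 'C(2 * n, i)%:R * legendre (n - i) 3.
Proof.
rewrite alpha_phi3_coef -{1}['X]expr1 phi3_coef_1DXpn.
by apply: eq_bigr => i _; rewrite mul1n.
Qed.

Lemma delta_legendre (n : nat) :
  (delta n)%:Z =
    \sum_(i < (2 * n).+1) 'C(2 * n, i)%:R * legendre (n - i).-1 3.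
Proof.
rewrite delta_phi3_coef -{1}['X]expr1 phi3_coef_1DXpn.
by apply: eq_bigr => i _; rewrite mul1n -!subn1 subnAC.
Qed.

Lemma alpha_mul_mod (p n : nat) :
  prime p -> (5 <= p)%N -> (0 < n)%N ->
  ((alpha (n * p))%:Z = legendre p 3 * (alpha n)%:Z %[mod (p ^ 2)%N%:Z])%Z.
Proof.
move=> p_pr p_ge5 n_gt0; rewrite alpha_phi3_coef.
have -> : (2 * (n * p) = p * (2 * n))%N by lia.
have e : (n * p = (n.-1 * p + p.-1).+1)%N by nia.
rewrite {1}e phi3_coef_frobenius //; last by rewrite modnMDl modn_small; lia.
rewrite -e phi3_coef_1DXpn alpha_legendre mulr_sumr.
congr (_ %% _)%Z; apply: eq_bigr => i _.
by rewrite (mulnC n p) -mulnBr legendre3M; ring.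
Qed.

Lemma delta_mul_mod (p n : nat) :
  prime p -> (5 <= p)%N -> (0 < n)%N ->
  ((delta (n * p))%:Z =
     \sum_(i < (2 * n).+1) 'C(2 * n, i)%:R * legendre (p * (n - i)).-1 3
     %[mod (p ^ 2)%N%:Z])%Z.
Proof.
move=> p_pr p_ge5 n_gt0; rewrite delta_phi3_coef.
have -> : (2 * (n * p) = p * (2 * n))%N by lia.
have e : ((n * p).-1 = (n.-1 * p + (p - 2)).+1)%N by nia.
rewrite {1}e phi3_coef_frobenius //; last by rewrite modnMDl modn_small; lia.
rewrite -e phi3_coef_1DXpn; congr (_ %% _)%Z; apply: eq_bigr => i _.
by rewrite mulnBr -!subn1 subnAC (mulnC n p).
Qed.

Theorem theorem1p2 (p n : nat)
  (p_pr : prime p) (p_ge5 : (5 <= p)%N) (n_gt0 : (0 < n)%N) :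
  ((alpha (n * p))%:Z = legendre p 3 * (alpha n)%:Z %[mod (p ^ 2)%N%:Z])%Z
  /\ ((p = 1 %[mod 3])%N ->
      ((beta (n * p))%:Z = (beta n)%:Z %[mod (p ^ 2)%N%:Z])%Z)
  /\ ((p = 2 %[mod 3])%N ->
      ((beta (n * p))%:Z = - (gamma n)%:Z %[mod (p ^ 2)%N%:Z])%Z).
Proof.
have p_gt0 : (0 < p)%N by lia.
have alpha_mod := alpha_mul_mod p_pr p_ge5 n_gt0.
have delta_mod := delta_mul_mod p_pr p_ge5 n_gt0.
have betaAD m : (beta m)%:Z = (alpha m)%:Z - (delta m)%:Z.
  by have := beta_delta m; lia.
split=> //; split=> p3.
  have lp : legendre p 3 = 1 by rewrite (legendre3_mod p3) legendre3E.
  rewrite !betaAD -modzDm -modzNm alpha_mod delta_mod modzNm modzDm lp mul1r.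
  congr ((_ - _) %% _)%Z; rewrite delta_legendre; apply: eq_bigr => i _.
  by rewrite legendre3_pred_mul1.
have lp : legendre p 3 = -1 by rewrite (legendre3_mod p3) legendre3E.
rewrite betaAD -modzDm -modzNm alpha_mod delta_mod modzNm modzDm lp.
have -> : \sum_(i < (2 * n).+1) 'C(2 * n, i)%:R * legendre (p * (n - i)).-1 3
          = (alpha n)%:Z + (delta n)%:Z.
  rewrite alpha_legendre delta_legendre -big_split; apply: eq_bigr => i _ /=.
  by rewrite legendre3_pred_mul2 // mulrDr.
by congr (_ %% _)%Z; have := gamma_beta n; have := betaAD n; lia.
Qed.
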